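(* A translation-invariant $p$-adic Gibbs measure for the $q$-state $p$-adic Potts model on the Cayley tree of order $k$ is bounded if and only if $q\notin p\mathbb N$.
   Context: $p$ is a prime, $\mathbb Q_p$ the field of $p$-adic numbers with norm $|\cdot|_p$; $p\mathbb N$ is the set of positive multiples of $p$. Cayley tree: $\Gamma^k=(V,L)$ is the infinite tree in which every vertex has exactly $k+1$ neighbours; $x^0\in V$ is a fixed root, $d$ the graph distance, $W_n=\{x\in V:d(x,x^0)=n\}$, $V_n=\bigcup_{j=0}^nW_j$. Potts model: spins take values in $\Phi=\{1,\dots,q\}$, $q\ge2$; the Hamiltonian is $H(\sigma)=J\sum_{\langle x,y\rangle\in L}\delta_{\sigma(x)\sigma(y)}$ with $J\in\mathbb Q_p$, $|J|_p<p^{-1/(p-1)}$. $H_n$ is the restriction of $H$ to $V_n$. $p$-adic Gibbs measure: a $p$-adic measure is a finitely additive $\mathbb Q_p$-valued function $\mu$ on an algebra $\mathcal B$ of sets; it is a probability measure if the total mass is $1$, and a $p$-adic probability measure is bounded if $\sup\{|\mu(A)|_p:A\in\mathcal B\}<\infty$. Given vectors $\tilde h_x=(\tilde h_{1,x},\dots,\tilde h_{q,x})\in\mathbb Q_p^q$, $x\in V$ (with entries in the domain of convergence of $\exp_p$), put $$\mu^{(n)}_{\tilde h}(\sigma_n)=Z_{n,\tilde h}^{-1}\exp_p\Big\{H_n(\sigma_n)+\sum_{x\in W_n}\tilde h_{\sigma_n(x),x}\Big\},\qquad \sigma_n\in\Phi^{V_n},$$ where $Z_{n,\tilde h}$ is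 the (nonzero) normalizing factor. If these are compatible, i.e. $\sum_{\omega_n\in\Phi^{W_n}}\mu^{(n)}_{\tilde h}(\sigma_{n-1}\vee\omega_n)=\mu^{(n-1)}_{\tilde h}(\sigma_{n-1})$ for all $n\ge1$ and $\sigma_{n-1}\in\Phi^{V_{n-1}}$ ($\vee$ is concatenation), they define a unique $p$-adic probability measure $\mu_{\tilde h}$ on the algebra of cylinder sets of $\Phi^V$, called a $p$-adic Gibbs measure. It is translation-invariant if the reduced vectors $h_x=(\tilde h_{i,x}-\tilde h_{q,x})_{i=1}^{q-1}$ do not depend on $x\in V$. *)

(* Defs.v *)
From HB Require Import structures.
From mathcomp Require Import all_boot all_order all_algebra finmap.
From mathcomp Require Import all_classical all_reals all_analysis.

Set Implicit Arguments.
Unset Strict Implicit.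
Unset Printing Implicit Defensive.

Import Order.TTheory GRing.Theory Num.Theory.
Import numFieldNormedType.Exports.

Local Open Scope classical_set_scope.
Local Open Scope card_scope.
Local Open Scope ring_scope.

(** ** The field of p-adic numbers *)

Definition rat_padic_norm (R : realType) (p : nat) (r : rat) : R :=
  if r == 0 then 0
  else p%:R ^ ((logn p `|denq r|%N)%:Z - (logn p `|numq r|%N)%:Z).

(** [padicField R p] is the completion of [rat] for the p-adic norm; [R] is
    only the field in which norms take their values.  Any two inhabitants are
    isometrically isomorphic by a unique isomorphism, so quantifying over this
    type amounts to speaking of Q_p.  MathComp-Analysis' normed structures
    cannot be used here: their axiom [`|x *+ n| = `|x| *+ n] excludes
    non-archimedean norms. *)
Record padicField (R : realType) (p : nat) := PadicField {
  padic_sort :> fieldType;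
  pnorm : padic_sort -> R;
  pnorm_eq0 : forall x, pnorm x = 0 -> x = 0;
  pnormM : forall x y, pnorm (x * y) = pnorm x * pnorm y;
  pnormD_max : forall x y, pnorm (x + y) <= Num.max (pnorm x) (pnorm y);
  pnorm_ratr : forall r : rat, pnorm (ratr r) = rat_padic_norm R p r;
  rat_dense : forall x (e : R), 0 < e -> exists r : rat, pnorm (x - ratr r) < e;
  padic_complete : forall u : nat -> padic_sort,
    (forall e : R, 0 < e -> exists N, forall m n,
       (N <= m)%N -> (N <= n)%N -> pnorm (u m - u n) < e) ->
    exists l, (fun n => pnorm (u n - l)) @ \oo --> (0 : R)
}.

Section Exponential.
Variables (R : realType) (p : nat) (Qp : padicField R p).

Definition padic_cvg_to (u : nat -> Qp) (l : Qp) : Prop :=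
  (fun n => pnorm (u n - l)) @ \oo --> (0 : R).

Definition exp_partial (x : Qp) (n : nat) : Qp :=
  \sum_(i < n) x ^+ i / (i`!)%:R.

Definition exp_domain : set Qp :=
  [set x | exists l, padic_cvg_to (exp_partial x) l].

(** Junk value [0] outside of [exp_domain]. *)
Definition exp_p (x : Qp) : Qp := xget 0 [set l | padic_cvg_to (exp_partial x) l].

End Exponential.

Definition pN (p : nat) : set nat :=
  [set (p * m)%N | m in [set m | (0 < m)%N]].

(** ** Cayley trees *)

Record cayleyTree (k : nat) := CayleyTree {
  vertex :> choiceType;
  adj : rel vertex;
  adj_sym : symmetric adj;
  adj_irrefl : irreflexive adj;
  adj_connected : forall x y, exists s, path adj x s /\ last x s = y;
  adj_acyclic : forall c, ucycle adj c -> (size c <= 2)%N;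
  adj_regular : forall x, [set y | adj x y] #= `I_k.+1;
  vertex_infinite : infinite_set [set: vertex]
}.

Section Balls.
Variables (k : nat) (V : cayleyTree k).

Definition walk (x y : V) (n : nat) : bool :=
  `[< exists s, [/\ path (@adj k V) x s, last x s = y & size s = n] >].

Lemma walk_ex (x y : V) : exists n, walk x y n.
Proof.
have [s [xs sy]] := adj_connected x y.
by exists (size s); apply/asboolP; exists s.
Qed.

Definition dist (x y : V) : nat := ex_minn (walk_ex x y).

(** [fset_set A] has the elements of [A] when [A] is finite, as spheres are. *)
Definition W (x0 : V) (n : nat) : {fset V} := fset_set [set x | dist x x0 = n].

Fixpoint Vn (x0 : V) (n : nat) : {fset V} :=
  if n is m.+1 then (Vn x0 m `|` W x0 n)%fset else W x0 0.

End Balls.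

(** ** Configurations *)

Section Configurations.
Variables (T : choiceType) (q : nat).

Definition restr (A : {fset T}) (s : T -> 'I_q) : {ffun A -> 'I_q} :=
  [ffun x => s (val x)].

Lemma in_fsetU_notinl (A B : {fset T}) (x : T) :
  x \in (A `|` B)%fset -> x \notin A -> x \in B.
Proof. by rewrite in_fsetU => /orP[->|]. Qed.

Definition concat (A B : {fset T}) (s : {ffun A -> 'I_q}) (w : {ffun B -> 'I_q}) :
    {ffun (A `|` B)%fset -> 'I_q} :=
  [ffun x : (A `|` B)%fset => match boolP (val x \in A) with
    | AltTrue xA => s [` xA]%fset
    | AltFalse xA => w [` in_fsetU_notinl (valP x) xA]%fset
    end].

Definition cylinder (A : set (T -> 'I_q)) : Prop :=
  exists (L : {fset T}) (B : set {ffun L -> 'I_q}), A = [set s | B (restr L s)].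

End Configurations.

(** ** p-adic measures on an algebra [B] of subsets of [X] *)

Section Measures.
Variables (R : realType) (p : nat) (Qp : padicField R p) (X : Type).
Variable B : set (set X).

(** Only the values of [mu] on [B] are meaningful. *)
Definition padic_measure (mu : set X -> Qp) : Prop :=
  forall A1 A2, B A1 -> B A2 -> A1 `&` A2 = set0 ->
    mu (A1 `|` A2) = mu A1 + mu A2.

Definition padic_probability (mu : set X -> Qp) : Prop :=
  padic_measure mu /\ mu setT = 1.

Definition padic_bounded (mu : set X -> Qp) : Prop :=
  exists M : R, forall A, B A -> pnorm (mu A) <= M.

End Measures.

(** ** The Potts model *)

Section Potts.
Variables (R : realType) (p : nat) (Qp : padicField R p).
Variables (k : nat) (V : cayleyTree k) (x0 : V) (q : nat).
Variable J : Qp.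

(** Edges are unordered pairs, encoded as the two-element sets [{x, y}]. *)
Definition is_edge (A : {fset V}) (E : {set A}) : bool :=
  [exists x : A, exists y : A, adj (val x) (val y) && (E == [set x; y]%SET)].

(** [hamiltonian s] is the Hamiltonian restricted to the edges with both
    endpoints in [A]; the boolean below is the Kronecker symbol of the spins
    at the two endpoints of [E]. *)
Definition hamiltonian (A : {fset V}) (s : {ffun A -> 'I_q}) : Qp :=
  J * \sum_(E : {set A} | is_edge E)
        [forall x in E, forall y in E, s x == s y]%:R.

Variable h : V -> 'I_q -> Qp.

Definition gibbs_weight (n : nat) (s : {ffun Vn x0 n -> 'I_q}) : Qp :=
  exp_p (hamiltonian s + \sum_(x : Vn x0 n | val x \in W x0 n) h (val x) (s x)).

Definition partition_function (n : nat) : Qp :=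
  \sum_(s : {ffun Vn x0 n -> 'I_q}) gibbs_weight s.

Definition gibbs_density (n : nat) (s : {ffun Vn x0 n -> 'I_q}) : Qp :=
  (partition_function n)^-1 * gibbs_weight s.

Definition compatible : Prop :=
  forall (n : nat) (s : {ffun Vn x0 n -> 'I_q}),
    \sum_(w : {ffun W x0 n.+1 -> 'I_q}) @gibbs_density n.+1 (concat s w)
    = gibbs_density s.

Definition gibbs_measure_of (mu : set (V -> 'I_q) -> Qp) : Prop :=
  [/\ forall x i, exp_domain (h x i),
      forall n, partition_function n != 0,
      compatible,
      padic_probability (@cylinder V q) mu
    & forall n (s : {ffun Vn x0 n -> 'I_q}),
        mu [set sigma | restr (Vn x0 n) sigma = s] = gibbs_density s].

End Potts.

(** The spins [1, ..., q] are represented by [0, ..., q - 1]. *)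
Lemma last_spin_subproof (q : nat) : (1 < q)%N -> (q.-1 < q)%N.
Proof. by case: q. Qed.

Definition last_spin (q : nat) (hq : (1 < q)%N) : 'I_q :=
  Ordinal (last_spin_subproof hq).

Section TranslationInvariance.
Variables (R : realType) (p : nat) (Qp : padicField R p).
Variables (k : nat) (V : cayleyTree k) (x0 : V).
Variables (q : nat) (hq : (1 < q)%N) (J : Qp).

Definition reduced (h : V -> 'I_q -> Qp) (x : V) : 'rV[Qp]_(q.-1) :=
  \row_i (h x (widen_ord (leq_pred q) i) - h x (last_spin hq)).

Definition translation_invariant_gibbs (mu : set (V -> 'I_q) -> Qp) : Prop :=
  exists h : V -> 'I_q -> Qp,
    gibbs_measure_of x0 J h mu /\ forall x y, reduced h x = reduced h y.

End TranslationInvariance.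

(* Main.v *)
Require Import Defs.
From mathcomp Require Import all_boot all_order all_algebra finmap.
From mathcomp Require Import all_classical all_reals all_analysis.
From mathcomp Require Import zify.

(** For [x] in the domain of the p-adic exponential, [exp x] lies in the open
    unit ball around [1], so the partition function [Z_n] is a sum of
    [q ^ #|V_n|] terms congruent to [1] modulo [p].  If [p] does not divide [q],
    then [|Z_n| = 1], every elementary cylinder has a measure of norm [1], and
    the ultrametric inequality bounds the measure of every cylinder by [1].
    If [p] divides [q], then compatibility at one fixed configuration on [V_n]
    shows that [Z_(n+1) / Z_n] has the norm of a sum of [q ^ #|W_(n+1)|] such
    terms, hence a norm at most [1/p]; so [Z_n] tends to [0] and the elementary
    cylinders, of norm [1/|Z_n|], have unbounded measures. *)

Set Implicit Arguments.
Unset Strict Implicit.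
Unset Printing Implicit Defensive.

Import Order.TTheory GRing.Theory Num.Theory.
Local Open Scope classical_set_scope.
Local Open Scope ring_scope.

(** * Legendre's formula for the valuation of factorials *)

Lemma logn_fact_trunc p n m : prime p -> (p ^ m <= n < p ^ m.+1)%N ->
  logn p n`! = (\sum_(1 <= k < m.+1) n %/ p ^ k)%N.
Proof.
move=> p_prime /andP[pmn npm]; have p1 := prime_gt1 p_prime.
rewrite logn_fact // (@big_cat_nat _ _ _ m.+1) //=; last first.
  by rewrite ltnS (leq_trans _ pmn) // ltnW // ltn_expl.
rewrite [X in (_ + X)%N]big_nat_cond [X in (_ + X)%N]big1 ?addn0 // => i.
rewrite andbT => /andP[mi _]; apply: divn_small.
by rewrite (leq_trans npm) // leq_exp2l.
Qed.

(** Strictness comes from the leading base-[p] digit of [n], which is at least 1. *)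
Lemma logn_fact_le p n : prime p -> (0 < n)%N ->
  (p.-1 * logn p n`! < n)%N.
Proof.
move=> p_prime n0; have p1 := prime_gt1 p_prime.
have /= bd := trunc_log_bounds p1 n0.
rewrite (logn_fact_trunc p_prime bd).
(* With [a = n %/ p ^ m], passing to [m.+1] replaces the summand [a] by [p * (a %/ p)], which is at
   most [a]. *)
have trunc_le m : (p.-1 * (\sum_(1 <= k < m.+1) n %/ p ^ k) + n %/ p ^ m <= n)%N.
  elim: m => [|m IH]; first by rewrite big_geq // muln0 expn0 divn1.
  rewrite big_nat_recr //= mulnDr.
  have := leq_divM (n %/ p ^ m) p.
  rewrite -divnMA -expnSr; move: IH; case: (p) p1 => // r _.
  by rewrite /= mulnS mulnC; lia.
apply: leq_trans (trunc_le (trunc_log p n)).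
rewrite -addn1 leq_add2l divn_gt0 ?expn_gt0 ?prime_gt0 //.
by case/andP: bd.
Qed.

(** Powers of [p] attain the bound of [logn_fact_le], so the exponential terms at these indices can
    detect divergence. *)
Lemma logn_fact_exp p j : prime p ->
  (p.-1 * logn p (p ^ j)`!)%N = (p ^ j).-1.
Proof.
move=> p_prime; have p1 := prime_gt1 p_prime; have p0 := prime_gt0 p_prime.
rewrite (@logn_fact_trunc _ _ j p_prime); last by rewrite leqnn ltn_exp2l /=.
rewrite predn_exp; congr muln.
rewrite big_add1 /= big_nat_rev /= big_mkord; apply: eq_bigr => i _.
rewrite add0n; have ij := ltn_ord i.
rewrite -expnB ?prime_gt0 //; last by lia.
by congr expn; lia.
Qed.

(** * The ultrametric norm *)

Section PadicNorm.
Variables (R : realType) (p : nat) (p_prime : prime p) (Qp : padicField R p).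
Implicit Types x y : Qp.

Let p_gt0 : 0 < p%:R :> R.
Proof. by rewrite ltr0n prime_gt0. Qed.

Let p_gt1 : 1 < p%:R :> R.
Proof. by rewrite ltr1n prime_gt1. Qed.

Lemma pnorm0 : pnorm (0 : Qp) = 0.
Proof. by have := pnorm_ratr Qp 0%:R; rewrite ratr_nat. Qed.

Lemma pnorm_nat m : (0 < m)%N -> pnorm (m%:R : Qp) = p%:R ^- logn p m.
Proof.
move=> m0; have := pnorm_ratr Qp m%:R.
rewrite ratr_nat /rat_padic_norm => ->; rewrite pnatr_eq0 -[m == _]negbK -lt0n m0 /=.
rewrite -[m%:R]/(m%:Z%:Q) numq_int denq_int /= logn1 sub0r.
by rewrite -exprz_inv -exprVn.
Qed.

Lemma pnorm1 : pnorm (1 : Qp) = 1.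
Proof. by rewrite -[1]/(1%:R) pnorm_nat // logn1 expr0 invr1. Qed.

Lemma pnormN1 : pnorm (-1 : Qp) = 1.
Proof.
rewrite -[-1]/((-1)%:~R) -ratr_int pnorm_ratr /rat_padic_norm.
by rewrite numq_int denq_int /= logn1.
Qed.

Lemma pnormN x : pnorm (- x) = pnorm x.
Proof. by rewrite -mulN1r pnormM pnormN1 mul1r. Qed.

(** Not an axiom of [padicField]: the ultrametric inequality for [x + (- x)] forces it. *)
Lemma pnorm_ge0 x : 0 <= pnorm x.
Proof.
have := pnormD_max x (- x); rewrite subrr pnorm0 pnormN.
by rewrite maxxx.
Qed.

Lemma pnormX x n : pnorm (x ^+ n) = pnorm x ^+ n.
Proof. by elim: n => [|n IH]; rewrite ?expr0 ?pnorm1 // !exprS pnormM IH. Qed.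

Lemma pnorm_gt0 x : x != 0 -> 0 < pnorm x.
Proof.
move=> x0; rewrite lt_neqAle pnorm_ge0 andbT eq_sym.
by apply: contra x0 => /eqP/pnorm_eq0->.
Qed.

Lemma pnormV x : pnorm x^-1 = (pnorm x)^-1.
Proof.
have [->|x0] := eqVneq x 0; first by rewrite invr0 pnorm0 invr0.
apply: (@mulfI _ (pnorm x)); first by rewrite gt_eqF // pnorm_gt0.
by rewrite -pnormM divff // divff ?pnorm1 // gt_eqF // pnorm_gt0.
Qed.

Lemma pnormBC x y : pnorm (x - y) = pnorm (y - x).
Proof. by rewrite -opprB pnormN. Qed.

Lemma pnormD_le c x y : pnorm x <= c -> pnorm y <= c -> pnorm (x + y) <= c.
Proof. by move=> xc yc; rewrite (le_trans (pnormD_max _ _)) // ge_max xc. Qed.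

Lemma pnormD_lt c x y : pnorm x < c -> pnorm y < c -> pnorm (x + y) < c.
Proof. by move=> xc yc; rewrite (le_lt_trans (pnormD_max _ _)) // gt_max xc. Qed.

Lemma pnorm_dist_lt c x y z :
  pnorm (x - z) < c -> pnorm (y - z) < c -> pnorm (x - y) < c.
Proof.
move=> xz yz; have -> : x - y = (x - z) + - (y - z) by rewrite opprB addrA subrK.
by apply: pnormD_lt; rewrite ?pnormN.
Qed.

Lemma pnorm_sum_le (I : Type) (r : seq I) (P : pred I) (F : I -> Qp) c :
  0 <= c -> (forall i, P i -> pnorm (F i) <= c) ->
  pnorm (\sum_(i <- r | P i) F i) <= c.
Proof.
move=> c0 Fc; elim/big_ind: _ => [|x y|//]; first by rewrite pnorm0.
exact: pnormD_le.
Qed.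

Lemma pnorm_sum_lt (I : Type) (r : seq I) (P : pred I) (F : I -> Qp) c :
  0 < c -> (forall i, P i -> pnorm (F i) < c) ->
  pnorm (\sum_(i <- r | P i) F i) < c.
Proof.
move=> c0 Fc; elim/big_ind: _ => [|x y|//]; first by rewrite pnorm0.
exact: pnormD_lt.
Qed.

Lemma pnorm_nat_le1 m : pnorm (m%:R : Qp) <= 1.
Proof.
case: m => [|m]; first by rewrite pnorm0 ler01.
by rewrite pnorm_nat // -exprVn exprn_ile1 ?invr_ge0 ?invf_le1 // ?ltW.
Qed.

Lemma pnorm_nat_coprime m : coprime p m -> pnorm (m%:R : Qp) = 1.
Proof.
move=> pm; have m0 : (0 < m)%N.
  case: m pm => // ; rewrite /coprime gcdn0 => /eqP p1.
  by move: p_prime; rewrite p1.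
by rewrite pnorm_nat // logn_coprime // expr0 invr1.
Qed.

Lemma pnorm_nat_dvd m : (p %| m)%N -> pnorm (m%:R : Qp) <= p%:R^-1.
Proof.
move=> /dvdnP[d ->]; rewrite natrM pnormM (@pnorm_nat p) ?prime_gt0 //.
by rewrite logn_prime // eqxx expr1 ler_piMl ?pnorm_nat_le1 // invr_ge0 ltW.
Qed.

(** Isosceles principle: were [pnorm y] below [pnorm x], so would be the norm of
    [(x - y) + y = x]. *)
Lemma pnorm_eq_of_lt x y : pnorm (x - y) < pnorm x -> pnorm y = pnorm x.
Proof.
move=> xy; apply/eqP; rewrite eq_le; apply/andP; split.
  have -> : y = x - (x - y) by rewrite opprB addrC subrK.
  by apply: pnormD_le => //; rewrite pnormN ltW.
rewrite leNgt; apply/negP => yx.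
by have := pnormD_lt xy yx; rewrite subrK ltxx.
Qed.

(* [p] is a uniformizer because every value of the norm is already taken on
   the rationals. *)
Lemma pnorm_lt1 x : pnorm x < 1 -> pnorm x <= p%:R^-1.
Proof.
have [->|x0] := eqVneq x 0; first by rewrite pnorm0 invr_ge0 ltW.
have [r xr] := rat_dense x (pnorm_gt0 x0).
rewrite -(pnorm_eq_of_lt xr) pnorm_ratr /rat_padic_norm.
case: eqP => [_ _|_]; first by rewrite invr_ge0 ltW.
move: (_ - _) => z.
rewrite -[X in _ < X](expr0z (p%:R : R)) -[_^-1]exprN1 ltr_eXz2l // ler_eXz2l //.
Qed.

Lemma pnorm_sum_near1 (I : finType) (F : I -> Qp) :
  (forall i, pnorm (F i - 1) < 1) -> pnorm (\sum_i F i - #|I|%:R) < 1.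
Proof.
move=> F1; rewrite -sum1_card natr_sum -sumrB.
by apply: pnorm_sum_lt => // i _; exact: F1.
Qed.

Lemma pnorm_near1 x : pnorm (x - 1) < 1 -> pnorm x = 1.
Proof.
rewrite pnormBC -[X in _ < X]pnorm1 => /pnorm_eq_of_lt ->.
exact: pnorm1.
Qed.

Lemma pnorm_sum_near1_coprime (I : finType) (F : I -> Qp) : coprime p #|I| ->
  (forall i, pnorm (F i - 1) < 1) -> pnorm (\sum_i F i) = 1.
Proof.
move=> /pnorm_nat_coprime I1 /pnorm_sum_near1.
by rewrite pnormBC -[X in _ < X]I1 => /pnorm_eq_of_lt ->.
Qed.

(** Discreteness of the norm turns the strict bound of [pnorm_sum_near1] into [1/p], a gain that can
    be iterated. *)
Lemma pnorm_sum_near1_dvd (I : finType) (F : I -> Qp) : (p %| #|I|)%N ->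
  (forall i, pnorm (F i - 1) < 1) -> pnorm (\sum_i F i) <= p%:R^-1.
Proof.
move=> /pnorm_nat_dvd Ip /pnorm_sum_near1 /pnorm_lt1 sum_p.
by rewrite -[X in pnorm X](subrK #|I|%:R); exact: pnormD_le.
Qed.

(** * Domain and values of the p-adic exponential *)

Lemma exp_partialS x n :
  exp_partial x n.+1 = exp_partial x n + x ^+ n / (n`!)%:R.
Proof. by rewrite /exp_partial big_ord_recr. Qed.

(** The power [p.-1] clears the root in the radius of convergence and produces the exponent that
    Legendre's formula controls. *)
Lemma pnorm_exp_term x n : (0 < n)%N ->
  pnorm (x ^+ n / (n`!)%:R) ^+ p.-1 =
  (pnorm x ^+ p.-1) ^+ n * p%:R ^+ (p.-1 * logn p n`!).
Proof.
move=> n0; rewrite pnormM pnormV pnormX pnorm_nat ?fact_gt0 // invrK.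
by rewrite exprMn -!exprM [(n * _)%N]mulnC [(logn _ _ * _)%N]mulnC.
Qed.

(* The condition [pnorm x < p ^ (- 1 / (p - 1))], without roots. *)
Definition exp_small x := p%:R * pnorm x ^+ p.-1 < 1.

Let p1_gt0 : (0 < p.-1)%N.
Proof. by have := prime_gt1 p_prime; lia. Qed.

(** The final [1/p] is the gain from strictness in [logn_fact_le]. *)
Lemma exp_term_small x n : (0 < n)%N ->
  pnorm (x ^+ n / (n`!)%:R) ^+ p.-1 <= (p%:R * pnorm x ^+ p.-1) ^+ n / p%:R.
Proof.
move=> n0; rewrite pnorm_exp_term // exprMn [X in X / _]mulrC -mulrA.
rewrite ler_wpM2l ?exprn_ge0 ?pnorm_ge0 // ler_pdivlMr // -exprSr.
by rewrite ler_weXn2l ?ltW // logn_fact_le.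
Qed.

Lemma padic_cvg_near (u : nat -> Qp) l e : padic_cvg_to u l -> 0 < e ->
  exists N, forall n, (N <= n)%N -> pnorm (u n - l) < e.
Proof.
move=> ul e0; have /cvgrPdist_lt/(_ _ e0)[N _ HN] := ul.
exists N => n Nn; have := HN n Nn.
by rewrite /= sub0r normrN ger0_norm ?pnorm_ge0.
Qed.

(** The terms of a convergent series tend to 0, but if [p * pnorm x ^ (p - 1) >= 1] then, by
    [logn_fact_exp], the terms of index [p ^ N] have [p.-1]-th power of norm at least [1/p]. *)
Lemma exp_domain_small x : exp_domain x -> exp_small x.
Proof.
move=> [l xl]; rewrite /exp_small ltNge; apply/negP => u1.
have pV0 : 0 < p%:R^-1 :> R by rewrite invr_gt0.
have [N HN] := padic_cvg_near xl pV0.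
have Nn : (N <= p ^ N)%N by rewrite ltnW // ltn_expl // prime_gt1.
have n0 : (0 < p ^ N)%N by rewrite expn_gt0 prime_gt0.
have term_lt : pnorm (x ^+ (p ^ N) / ((p ^ N)`!)%:R) < p%:R^-1.
  rewrite -[X in pnorm X](addKr (exp_partial x (p ^ N))) -exp_partialS addrC.
  by apply: (@pnorm_dist_lt _ _ _ l); apply: HN; rewrite // ltnW.
(* The term has norm below 1, so its power is no larger than itself. *)
have term_le : pnorm (x ^+ (p ^ N) / ((p ^ N)`!)%:R) ^+ p.-1 < p%:R^-1.
  apply: le_lt_trans (term_lt).
  by rewrite ler_iXnr ?pnorm_ge0 // ltW // (lt_trans term_lt) // invf_lt1.
move: term_le; rewrite pnorm_exp_term // logn_fact_exp //.
rewrite -(ltr_pM2l p_gt0) divff ?gt_eqF // mulrCA -exprS prednK //.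
by rewrite -exprMn mulrC ltNge exprn_ege1.
Qed.

Lemma exp_term_cvg x e : exp_small x -> 0 < e ->
  exists N, forall n, (N <= n)%N -> pnorm (x ^+ n / (n`!)%:R) < e.
Proof.
move=> xs e0; have u0 : 0 <= p%:R * pnorm x ^+ p.-1.
  by rewrite mulr_ge0 ?exprn_ge0 ?pnorm_ge0 // ltW.
have /cvg_expr/cvgrPdist_lt/(_ _ (exprn_gt0 p.-1 e0))[N _ HN] :
  `|p%:R * pnorm x ^+ p.-1| < 1 by rewrite ger0_norm.
(* The shift to [N.+1] ensures [0 < n], as [exp_term_small] requires. *)
exists N.+1 => n Nn; have := HN n (ltnW Nn).
rewrite /= sub0r normrN ger0_norm ?exprn_ge0 // => un.
rewrite -(ltr_pXn2r p1_gt0) ?nnegrE ?pnorm_ge0 ?ltW //.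
apply: le_lt_trans un; apply: le_trans (exp_term_small _ _) _.
  exact: leq_trans Nn.
by rewrite ler_piMr ?exprn_ge0 // invf_le1 // ltW.
Qed.

(** Tails need no summation estimate: by the ultrametric inequality, adding terms of norm below [e]
    stays below [e]. *)
Lemma exp_partial_near x N e :
  0 < e -> (forall n, (N <= n)%N -> pnorm (x ^+ n / (n`!)%:R) < e) ->
  forall n, (N <= n)%N -> pnorm (exp_partial x n - exp_partial x N) < e.
Proof.
move=> e0 H n /subnK <-; elim: (n - N)%N => [|m IH].
  by rewrite add0n subrr pnorm0.
rewrite addSn exp_partialS addrAC; apply: pnormD_lt => //.
by apply: H; rewrite leq_addl.
Qed.

(** Completeness provides a limit, so [xget] returns it rather than the default [0]. *)
Lemma exp_p_cvg x : exp_small x -> padic_cvg_to (exp_partial x) (exp_p x).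
Proof.
move=> xs; apply: (@xgetPex _ 0 [set l | padic_cvg_to (exp_partial x) l]).
apply: padic_complete => e e0; have [N HN] := exp_term_cvg xs e0.
exists N => m n Nm Nn.
by apply: (@pnorm_dist_lt _ _ _ (exp_partial x N)); apply: exp_partial_near.
Qed.

Lemma exp_p_near1 x : exp_small x -> pnorm (exp_p x - 1) < 1.
Proof.
move=> xs; have [N HN] := padic_cvg_near (exp_p_cvg xs) ltr01.
(* Viewing 1 as a partial sum reduces the claim to the terms of positive index. *)
have -> : 1 = exp_partial x 1.
  by rewrite /exp_partial big_ord1 expr0 divr1.
(* Passing through one partial sum close to the limit keeps the inequality strict; [N.+1] is at
   least the starting index 1. *)
apply: (@pnorm_dist_lt _ _ _ (exp_partial x N.+1)).
  by rewrite pnormBC; apply: HN.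
rewrite pnormBC; apply: exp_partial_near => // n n0.
rewrite -(ltr_pXn2r p1_gt0) ?nnegrE ?pnorm_ge0 ?expr1n //.
apply: le_lt_trans (exp_term_small _ n0) _.
rewrite ltr_pdivrMr // mul1r (le_lt_trans _ p_gt1) // exprn_ile1 //.
  by rewrite mulr_ge0 ?exprn_ge0 ?pnorm_ge0 // ltW.
exact: ltW.
Qed.

Lemma exp_small_le x y : pnorm y <= pnorm x -> exp_small x -> exp_small y.
Proof.
move=> yx; apply: le_lt_trans; rewrite ler_pM2l //.
by rewrite lerXn2r ?nnegrE ?pnorm_ge0.
Qed.

Lemma exp_small0 : exp_small 0.
Proof. by rewrite /exp_small pnorm0 expr0n gtn_eqF // mulr0 ltr01. Qed.

Lemma exp_smallD x y : exp_small x -> exp_small y -> exp_small (x + y).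
Proof.
move=> xs ys; have := pnormD_max x y.
by case: (leP (pnorm x)) => _ H; exact: (exp_small_le H).
Qed.

Lemma exp_smallM x y : pnorm y <= 1 -> exp_small x -> exp_small (x * y).
Proof. by move=> y1; apply: exp_small_le; rewrite pnormM ler_piMr ?pnorm_ge0. Qed.

Lemma exp_small_powR x : pnorm x < p%:R `^ (- (p%:R - 1)^-1) -> exp_small x.
Proof.
have p1R : p%:R - 1 = p.-1%:R :> R.
  by rewrite -[in LHS](prednK (prime_gt0 p_prime)) -natr1 addrK.
rewrite p1R => xs; rewrite /exp_small -ltr_pdivlMl // mulr1.
have -> : p%:R^-1 = (p%:R `^ (- (p.-1%:R)^-1)) ^+ p.-1 :> R.
  rewrite -powR_mulrn ?powR_ge0 // -powRrM mulNr mulVf ?powR_inv1 ?ltW //.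
  by rewrite pnatr_eq0 -lt0n.
by rewrite ltrXn2r ?pnorm_ge0 // -lt0n p1_gt0.
Qed.

End PadicNorm.

(** * Spheres and balls of the tree *)

Section Spheres.
Variables (k : nat) (V : cayleyTree k).
Implicit Types x y z : V.

Lemma dist_walk x y : walk x y (dist x y).
Proof. by rewrite /dist; case: ex_minnP. Qed.

Lemma dist_le x y n : walk x y n -> (dist x y <= n)%N.
Proof. by rewrite /dist; case: ex_minnP => m _; apply. Qed.

Lemma dist_adj x y z : adj x y -> (dist x z <= (dist y z).+1)%N.
Proof.
move=> xy; have /asboolP[s [ys sz ss]] := dist_walk y z.
by apply: dist_le; apply/asboolP; exists (y :: s); rewrite /= xy ys ss.
Qed.

Lemma dist_step x z n : dist x z = n.+1 -> exists2 y, adj y x & dist y z = n.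
Proof.
move=> dxz; have := dist_walk x z; rewrite dxz => /asboolP[[|y s] [//= +]].
move=> /andP[xy ys] sz [sn]; exists y; first by rewrite adj_sym.
apply/eqP; rewrite eqn_leq; apply/andP; split.
  by apply: dist_le; apply/asboolP; exists s.
by rewrite -ltnS -dxz dist_adj.
Qed.

(** Each sphere lies in the union of the finite neighbourhoods of the previous one. This makes
    [fset_set] in [W] faithful. *)
Lemma sphere_finite z n : finite_set [set x : V | dist x z = n].
Proof.
elim: n => [|n IH].
  apply: (sub_finite_set _ (finite_set1 z)) => x /= dxz.
  by have := dist_walk x z; rewrite dxz => /asboolP[[|y s] []].
have nbr_finite y : finite_set [set x | adj y x].
  by apply/finite_setP; exists k.+1; exact: adj_regular.
apply: (sub_finite_set _ (bigcup_finite IH (fun y _ => nbr_finite y))) => x /=.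
by move=> /dist_step[y yx dyz]; exists y.
Qed.

(** A geodesic to [z] meets every smaller distance, so an empty sphere would confine the infinite
    tree to finitely many finite spheres. *)
Lemma sphere_nonempty z n : exists x : V, dist x z = n.
Proof.
have down m x : (n <= m)%N -> dist x z = m -> exists y, dist y z = n.
  move/subnK <-; elim: (m - n)%N x => [|d IH] x; first by exists x.
  by rewrite addSn => /dist_step[y _]; exact: IH.
apply: contrapT => noW; apply: (@vertex_infinite _ V).
have := bigcup_finite (finite_II n) (fun i _ => sphere_finite z i).
apply: sub_finite_set => x _; exists (dist x z) => //=.
by rewrite ltnNge; apply/negP => /down/(_ erefl).
Qed.

Lemma in_W z n x : (x \in W z n) = (dist x z == n).
Proof.
rewrite in_fset_set; last exact: sphere_finite.
by apply/idP/eqP; rewrite inE.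
Qed.

Lemma in_Vn z n x : (x \in Vn z n) = (dist x z <= n)%N.
Proof.
elim: n => [|n IH]; first by rewrite in_W leqn0.
by rewrite /= in_fsetU IH in_W [RHS]leq_eqVlt orbC ltnS.
Qed.

Lemma card_W_gt0 z n : (0 < #|{: W z n}|)%N.
Proof.
have [x /eqP] := sphere_nonempty z n.
by rewrite -in_W => xW; apply/card_gt0P; exists [` xW]%fset.
Qed.

Lemma fsub_Vn z (L : {fset V}) : exists n, (L `<=` Vn z n)%fset.
Proof.
exists (\max_(x : L) dist (val x) z); apply/fsubsetP => x xL.
by rewrite in_Vn (@leq_bigmax _ (fun y : L => dist (val y) z) [` xL]%fset).
Qed.

End Spheres.

(** * Measures of cylinders *)

Lemma restr_fsub (T : choiceType) q (K L : {fset T}) (s t : T -> 'I_q) :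
  (L `<=` K)%fset -> restr K s = restr K t -> restr L s = restr L t.
Proof.
move=> /fsubsetP LK st; apply/ffunP => x; rewrite !ffunE.
have xK := LK _ (valP x).
by have /ffunP/(_ [` xK]%fset) := st; rewrite !ffunE.
Qed.

Section MeasureOfCylinders.
Variables (R : realType) (p : nat) (p_prime : prime p) (Qp : padicField R p).
Variables (T : choiceType) (q : nat) (mu : set (T -> 'I_q) -> Qp).
Hypothesis mu_add : padic_measure (@cylinder T q) mu.

Lemma padic_measure0 : mu set0 = 0.
Proof.
have cyl0 : @cylinder T q set0 by exists fset0, set0.
have := mu_add cyl0 cyl0 (set0I _); rewrite setU0.
by move/(congr1 (fun a => a - mu set0)); rewrite subrr addrK.
Qed.

(** The set is a finite disjoint union of elementary cylinders, and the ultrametric bound does not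
    grow with their number. *)
Lemma pnorm_cylinder_le (L : {fset T}) (B : set {ffun L -> 'I_q}) c :
  0 <= c -> (forall s, pnorm (mu [set sigma | restr L sigma = s]) <= c) ->
  pnorm (mu [set sigma | B (restr L sigma)]) <= c.
Proof.
move=> c0 mu_le.
have -> : [set sigma | B (restr L sigma)] =
    [set sigma | restr L sigma \in [seq s <- enum {ffun L -> 'I_q} | s \in B]].
  by apply/seteqP; split=> s /=; rewrite mem_filter mem_enum andbT inE.
elim: [seq s <- _ | _] => [|a r IH].
  have -> : [set sigma : T -> 'I_q | restr L sigma \in [::]] = set0.
    by apply/seteqP; split.
  by rewrite padic_measure0 pnorm0.
(* A repeated entry leaves the union unchanged; a new one contributes a disjoint piece. *)
have [ar|ar] := boolP (a \in r).
  have -> : [set sigma | restr L sigma \in a :: r] =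
            [set sigma | restr L sigma \in r].
    apply/seteqP; split=> s /=; rewrite inE; first by case/orP=> [/eqP->|].
    by move=> ->; rewrite orbT.
  exact: IH.
have -> : [set sigma | restr L sigma \in a :: r] =
    [set sigma | restr L sigma = a] `|` [set sigma | restr L sigma \in r].
  apply/seteqP; split=> s /=; rewrite inE.
    by case/orP => [/eqP|]; [left|right].
  by case=> [->|->]; rewrite ?eqxx ?orbT.
rewrite mu_add; first exact: pnormD_le.
- by exists L, [set a].
- by exists L, [set s | s \in r].
- by apply/seteqP; split=> // s [/= ->]; rewrite (negbTE ar).
Qed.

End MeasureOfCylinders.

(** * Norms of weights and partition functions *)

Section GibbsMeasure.
Variables (R : realType) (p : nat) (p_prime : prime p) (Qp : padicField R p).
Variables (k : nat) (V : cayleyTree k) (x0 : V) (q : nat) (q_gt0 : (0 < q)%N).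
Variables (J : Qp) (h : V -> 'I_q -> Qp).
Hypotheses (J_small : exp_small J) (h_dom : forall x i, exp_domain (h x i)).

(** The exponent stays in the ball [exp_small], which is closed under sums and under multiplication
    by elements of norm at most 1, such as the integer multiplying [J]. *)
Lemma gibbs_weight_near1 n (s : {ffun Vn x0 n -> 'I_q}) :
  pnorm (gibbs_weight J h s - 1) < 1.
Proof.
apply: exp_p_near1 => //; apply: (exp_smallD p_prime).
  rewrite /hamiltonian; apply: (exp_smallM p_prime) => //.
  by apply: pnorm_sum_le => // E _; exact: pnorm_nat_le1.
elim/big_ind: _ => [|x y|x _]; [exact: exp_small0|exact: (exp_smallD p_prime)|].
exact: exp_domain_small.
Qed.

Lemma pnorm_gibbs_density n (s : {ffun Vn x0 n -> 'I_q}) :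
  pnorm (gibbs_density J h s) = (pnorm (partition_function x0 J h n))^-1.
Proof.
by rewrite pnormM pnormV (pnorm_near1 (gibbs_weight_near1 s)) mulr1.
Qed.

Lemma pnorm_partition_function_coprime n :
  coprime p q -> pnorm (partition_function x0 J h n) = 1.
Proof.
move=> pq; apply: pnorm_sum_near1_coprime => //.
  by rewrite card_ffun card_ord coprimeXr.
exact: gibbs_weight_near1.
Qed.

Lemma pnorm_partition_function_dvd n :
  (forall n, partition_function x0 J h n != 0) -> compatible x0 J h ->
  (p %| q)%N -> pnorm (partition_function x0 J h n) <=
                pnorm (partition_function x0 J h 0) / p%:R ^+ n.
Proof.
move=> Z_neq0 cpt pq; elim: n => [|n IH]; first by rewrite divr1.
(* Any configuration would serve, since all densities on [Vn x0 n] have the same norm. *)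
pose s : {ffun Vn x0 n -> 'I_q} := [ffun=> Ordinal q_gt0].
have /(congr1 (@pnorm _ _ _)) := cpt n s.
rewrite -mulr_sumr pnorm_gibbs_density pnormM pnormV // => Zs.
have -> : pnorm (partition_function x0 J h n.+1) =
    pnorm (partition_function x0 J h n) * pnorm
      (\sum_(w : {ffun W x0 n.+1 -> 'I_q})
         @gibbs_weight _ _ _ _ _ _ _ J h n.+1 (concat s w)).
  apply/(mulfI (_ : (pnorm (partition_function x0 J h n.+1))^-1 != 0)).
    by rewrite invr_neq0 // gt_eqF // pnorm_gt0.
  rewrite mulVf ?gt_eqF ?pnorm_gt0 // mulrCA Zs mulfV //.
  by rewrite gt_eqF // pnorm_gt0.
rewrite exprSr invfM mulrA; apply: ler_pM; rewrite ?pnorm_ge0 //.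
apply: pnorm_sum_near1_dvd => //; last by move=> w; exact: gibbs_weight_near1.
(* The sphere is nonempty, so [q] occurs with a positive exponent and [p] divides the number of
   terms. *)
by rewrite card_ffun card_ord dvdn_exp // card_W_gt0.
Qed.

End GibbsMeasure.

(** * The boundedness criterion *)

Lemma pN_dvdn p q : (0 < q)%N -> pN p q <-> (p %| q)%N.
Proof.
move=> q0; split=> [[m _ <-]|/dvdnP[m qE]]; first exact: dvdn_mulr.
exists m; last by rewrite qE mulnC.
by move: q0; rewrite /= qE muln_gt0 => /andP[].
Qed.

Theorem theorem11 (R : realType) (p : nat) (p_prime : prime p)
    (Qp : padicField R p) (k : nat) (V : cayleyTree k) (x0 : V)
    (q : nat) (q_ge2 : (1 < q)%N) (J : Qp)
    (J_small : pnorm J < p%:R `^ (- (p%:R - 1)^-1))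
    (mu : set (V -> 'I_q) -> Qp)
    (mu_gibbs : translation_invariant_gibbs x0 q_ge2 J mu) :
  padic_bounded (@cylinder V q) mu <-> ~ pN p q.
Proof.
have [h [[h_dom Z_neq0 cpt [mu_add _] muE] _]] := mu_gibbs.
have {}J_small := exp_small_powR p_prime J_small.
have q_gt0 := ltnW q_ge2; rewrite pN_dvdn //; split=> [[M mu_le] pq|/negP pq].
  pose s n : {ffun Vn x0 n -> 'I_q} := [ffun=> Ordinal q_gt0].
  have cyl n : @cylinder V q [set sigma | restr (Vn x0 n) sigma = s n].
    by exists (Vn x0 n), [set s n].
  have Z0 := pnorm_gt0 (Z_neq0 0%N).
  have p_lt1 : `|p%:R^-1 : R| < 1.
    rewrite ger0_norm ?invr_ge0 ?ler0n //.
    by rewrite invf_lt1 ?ltr1n ?ltr0n ?prime_gt1 ?prime_gt0.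
  have M0 : 0 < M.
    apply: lt_le_trans (mu_le _ (cyl 0%N)).
    by rewrite muE pnorm_gibbs_density // invr_gt0.
  (* A bound [M] would give [1/M <= |Z_N| <= |Z_0| / p ^ N], hence [p ^ (- N) >= e] for every
     [N]. *)
  pose e := (pnorm (partition_function x0 J h 0) * M)^-1.
  have e0 : 0 < e by rewrite invr_gt0 mulr_gt0.
  have /cvgrPdist_lt/(_ _ e0)[N _ /(_ N (leqnn N))] := cvg_expr p_lt1.
  rewrite /= sub0r normrN ger0_norm ?exprn_ge0 ?invr_ge0 ?ler0n // ltNge.
  move=> /negP; apply.
  have := mu_le _ (cyl N).
  rewrite muE pnorm_gibbs_density // invf_ple ?posrE ?pnorm_gt0 // => MZ.
  have := le_trans MZ (pnorm_partition_function_dvd p_prime q_gt0 J_small h_dom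
                         N Z_neq0 cpt pq).
  by rewrite /e invfM ler_pdivrMl // exprVn.
exists 1 => _ [L [B ->]]; have [n LV] := fsub_Vn x0 L.
(* The cylinder is lifted to a ball containing [L], where [muE] applies. Restriction to the ball
   determines restriction to [L], so the choice of the extension [sigma] is immaterial. *)
pose B' : set {ffun Vn x0 n -> 'I_q} :=
  [set s | exists2 sigma, restr (Vn x0 n) sigma = s & B (restr L sigma)].
have -> : [set sigma | B (restr L sigma)] =
          [set sigma | B' (restr (Vn x0 n) sigma)].
  apply/seteqP; split=> s /=; first by exists s.
  by case=> t /(restr_fsub LV) <-.
apply: pnorm_cylinder_le => // s.
rewrite muE pnorm_gibbs_density // pnorm_partition_function_coprime ?invr1 //.
by rewrite prime_coprime.
Qed.
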